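(* Let $M>m>0$ be real numbers, let $\mathcal{H}$ be a complex Hilbert space and let $A,B\in\mathcal{B}(\mathcal{H})$. (i) If $C_{M,m}(A)$ is accretive, then $\omega(AB-BA^* )\le (M-m)\,\omega(B)$. (ii) If $C_{M,m}(\mathrm{i}A)$ is accretive, then $\omega(AB+BA^* )\le (M-m)\,\omega(B)$.
   Context: $\mathcal{B}(\mathcal{H})$ is the algebra of bounded linear operators on $\mathcal{H}$, with identity $I$. $C_{M,m}(T)=(MI-T^* )(T-mI)$. $T$ is accretive if $\mathfrak{R}T=\frac{T+T^*}{2}$ is positive semi-definite. The numerical radius is $\omega(T)=\sup\{|\langle Tx,x\rangle|: x\in\mathcal{H},\ \|x\|=1\}$. *)

(* Defs.v *)
From HB Require Import structures.
From mathcomp Require Import all_boot all_order all_algebra.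
From mathcomp Require Import all_classical all_reals all_analysis.
From mathcomp Require Import sesquilinear complex.

Set Implicit Arguments.
Unset Strict Implicit.
Unset Printing Implicit Defensive.

Import Order.TTheory GRing.Theory Num.Theory.
Import numFieldNormedType.Exports.

Local Open Scope classical_set_scope.
Local Open Scope ring_scope.
Local Open Scope complex_scope.

(* A complex Hilbert space is a complete normed space over R[i] whose norm comes
   from an inner product.  As for every [{dot _ for _}], the inner product is
   linear in its first argument and conjugate-linear in the second. *)
HB.mixin Record CompleteNormedModule_hasInner (R : realType) H
    & CompleteNormedModule R[i] H := {
  inner : {dot H for @Num.conj R[i]};
  inner_norm : forall x : H, inner x x = `|x| ^+ 2
}.

#[short(type="hilbertType")]
HB.structure Definition Hilbert (R : realType) :=
  {H of CompleteNormedModule R[i] H & CompleteNormedModule_hasInner R H}.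

Section Operators.
Context {R : realType} {H : hilbertType R}.
Implicit Types T : H -> H.

Definition bounded_operator T :=
  linear T /\ exists c : R, forall x, `|T x| <= c%:C * `|x|.

(* For a bounded operator [T] such a map exists, by the Riesz representation
   theorem, and is unique (and is itself a bounded operator), so that [get]
   returns the Hilbert space adjoint of [T]. *)
Definition adjoint T : H -> H :=
  get [set S : H -> H | forall x y, inner (T x) y = inner x (S y)].

Definition Re_op T : H -> H := 2^-1 \*: (T \+ adjoint T).

(* The order of R[i] is partial: [0 <= z] says that [z] is real and
   nonnegative. *)
Definition positive_semidefinite T := forall x, 0 <= inner (T x) x.

Definition accretive T := positive_semidefinite (Re_op T).

(* (M I - T^* ) (T - m I) *)
Definition C_op (M m : R) T : H -> H :=
  (M%:C \*: idfun \- adjoint T) \o (T \- m%:C \*: idfun).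

(* The set is bounded when [T] is a bounded operator; it is empty when H is the
   zero space, and then [sup set0 = 0]. *)
Definition numerical_radius T : R :=
  sup [set Normc.normc (inner (T x) x) | x in [set x : H | `|x| = 1]].

End Operators.

(* Main.v *)
Require Import Defs.
From mathcomp Require Import all_boot all_order all_algebra.
From mathcomp Require Import all_classical all_reals all_analysis.
From mathcomp Require Import sesquilinear complex.
From mathcomp Require Import ring lra.
Import Order.TTheory GRing.Theory Num.Theory.
Import numFieldNormedType.Exports.
Local Open Scope classical_set_scope.
Local Open Scope ring_scope.

(** Let [c = (M + m) / 2] and [r = (M - m) / 2].  Expanding
    [Re <(A x - m x), (M x - A x)>] around the midpoint [c] turns accretivity of
    [C_op M m A] into a statement about a ball: [`|A x - c x| <= r `|x|] for all
    [x] ([accretive_C_op_norm_le]).  The adjoint [A^* - c] of [A - c] has the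
    same bound ([adjoint_norm_le]), so for a unit vector [x] one can write
    [A^* x = c x + r v] with [`|v| <= 1].  As [c] is real, it disappears from
    [<(A B - B A^* ) x, x> = <B x, A^* x> - <B A^* x, x>], which is therefore
    [r (<B x, v> - <B v, x>)].

    Polarization writes the skew expression [<B x, v> - <B v, x>] as a
    combination of two values of the quadratic form of [B], at [x + i v] and
    [x - i v].  Each is controlled by the numerical radius of [B], and the
    parallelogram identity adds up the squared norms, giving the bound
    [w(B) (`|x|^2 + `|v|^2) <= 2 w(B)] ([skew_inner_le]).  This is (i), with
    constant [2 r = M - m].  For (ii), apply (i) to [i A]: its adjoint is
    [- i A^*], so that [(i A) B - B (i A)^* = i (A B + B A^* )], and a factor of
    modulus one leaves the numerical radius unchanged.

    All this presupposes that [adjoint A] is an adjoint of [A], that is, the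
    Riesz representation theorem ([riesz_representation]).  A functional [f] is
    represented by the minimizer of [`|x|^2 - 2 Re (f x)].  Approximate
    minimizers already represent [f] up to a small multiple of the norm, and two
    vectors that almost represent the same functional are close to each other;
    hence they form a Cauchy sequence, whose limit represents [f]. *)

(** * Inner products and norms *)

Section HilbertOperators.
Set Implicit Arguments.
Unset Strict Implicit.
Context {R : realType} {H : hilbertType R}.
Implicit Types x y z : H.
Local Notation "''[' u , v ]" := (@inner R H u v).
Local Notation "x %:C" := (real_complex R x).
Local Notation re := (@complex.Re R).

Lemma innerDl x y z : '[x + y, z] = '[x, z] + '[y, z].
Proof. exact: linearDl. Qed.
Lemma innerDr x y z : '[x, y + z] = '[x, y] + '[x, z].
Proof. exact: linearDr. Qed.
Lemma innerNl x y : '[- x, y] = - '[x, y].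
Proof. exact: linearNl. Qed.
Lemma innerNr x y : '[x, - y] = - '[x, y].
Proof. exact: linearNr. Qed.
Lemma innerBl x y z : '[x - y, z] = '[x, z] - '[y, z].
Proof. exact: linearBl. Qed.
Lemma innerBr x y z : '[x, y - z] = '[x, y] - '[x, z].
Proof. exact: linearBr. Qed.
Lemma innerZl a x y : '[a *: x, y] = a * '[x, y].
Proof. exact: linearZl_LR. Qed.
Lemma innerZr a x y : '[x, a *: y] = a^* * '[x, y].
Proof. exact: linearZr_LR. Qed.
Lemma inner0l x : '[0, x] = 0.
Proof. exact: linear0l. Qed.
Lemma inner0r x : '[x, 0] = 0.
Proof. exact: linear0r. Qed.
Lemma innerC x y : '[x, y] = ('[y, x])^*.
Proof. by rewrite (hermC inner) mul1r. Qed.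

Lemma conj_real (a : R) : (a%:C)^* = a%:C :> R[i].
Proof. by apply: CrealP; apply/complex_realP; exists a. Qed.

Lemma parallelogram x y :
  `|x + y| ^+ 2 + `|x - y| ^+ 2 = 2 * (`|x| ^+ 2 + `|y| ^+ 2).
Proof.
by rewrite -!inner_norm !(innerDl, innerDr, innerNl, innerNr); ring.
Qed.

(** The squared norm of the component of [x] orthogonal to [y] is
    nonnegative. *)
Lemma cauchy_schwarz x y : `|'[x, y]| <= `|x| * `|y|.
Proof.
have [->|y0] := eqVneq y 0.
  by rewrite inner0r normr0 mulr_ge0.
have n0 : `|y| != 0 by rewrite normr_eq0.
have ngt0 : 0 < `|y| ^+ 2 by rewrite exprn_gt0 ?normr_gt0.
rewrite -(@ler_pXn2r _ 2) ?nnegrE ?mulr_ge0 // exprMn -ler_pdivrMr //.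
pose a := '[x, y] / `|y| ^+ 2.
have : 0 <= `|x - a *: y| ^+ 2 by rewrite exprn_ge0.
rewrite -inner_norm !(innerBl, innerBr, innerZl, innerZr) !inner_norm.
have -> : a^* = ('[x, y])^* / `|y| ^+ 2.
  by rewrite /a fmorph_div /= (geC0_conj (ltW ngt0)).
rewrite (innerC y x) /a normCK.
set p := '[x, y]; set q := Num.conj p; move=> pos.
rewrite -subr_ge0; apply: le_trans pos _; rewrite le_eqVlt.
by apply/orP; left; apply/eqP; field; exact: n0.
Qed.

Lemma ReD (a b : R[i]) : re (a + b) = re a + re b.
Proof. by case: a => ? ?; case: b. Qed.

Lemma ReN (a : R[i]) : re (- a) = - re a.
Proof. by case: a. Qed.

Lemma Re_conjB (a : R[i]) : re (a^* - a) = 0.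
Proof. by case: a => a1 a2 /=; rewrite subrr. Qed.

Lemma norm_complex (z : R[i]) : `|z| = (Normc.normc z)%:C.
Proof. by case: z. Qed.

(** The norm of [H] takes its values in [R[i]]; this exposes it as a real number
    so that real arithmetic applies. *)
Lemma norm_ReE x : `|x| = (re `|x|)%:C :> R[i].
Proof. by rewrite RRe_real // ger0_real. Qed.

Lemma Re_norm_ge0 x : 0 <= re `|x|.
Proof. by rewrite -ler0c -norm_ReE. Qed.

Lemma gt0_complex_real (e : R[i]) : 0 < e -> exists2 r : R, 0 < r & e = r%:C.
Proof.
by case: e => a b; rewrite ltcE /= => /andP[/eqP -> a0]; exists a.
Qed.

(** * The Riesz representation theorem *)

(** With [Q x = `|x|^2 - 2 Re (f x)], bounded below since [f] is bounded, any [x]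
    with [Q x < inf Q + e^2] works: for [h <> 0] and [w = <h, x> - f h],
    the best move from [x] along the line of [h] lowers [Q] by
    [`|w|^2 / `|h|^2], which must therefore be less than [e^2]. *)
Lemma riesz_representation_approx (f : H -> R[i]) (c e : R) :
  (forall a x y, f (a *: x + y) = a * f x + f y) ->
  (forall x, `|f x| <= c%:C * `|x|) -> 0 < e ->
  exists x, forall h, `|'[h, x] - f h| <= e%:C * `|h|.
Proof.
move=> flin fbnd e0.
pose Q x : R := re ('[x, x] - 2 * f x).
have QE x h (s : R) : let w := '[h, x] - f h in
    Q (x + (- s%:C * w^* ) *: h) =
    Q x - 2 * s * Normc.normc w ^+ 2
        + s ^+ 2 * Normc.normc w ^+ 2 * re `|h| ^+ 2.
  move=> w; set t := - s%:C * _; set nw := Normc.normc w; set N := re _.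
  have ww : w * w^* = (nw ^+ 2)%:C.
    by rewrite -normCK norm_complex rmorphXn.
  (* The last summand has zero real part; it makes the two sides equal before
     taking real parts. *)
  have -> : Q x - 2 * s * nw ^+ 2 + s ^+ 2 * nw ^+ 2 * N ^+ 2 =
    re (('[x, x] - 2 * f x) + (- 2 * s * nw ^+ 2 + s ^+ 2 * nw ^+ 2 * N ^+ 2)%:C
       + ((t * '[h, x])^* - t * '[h, x])).
    by rewrite ReD Re_conjB ReD /= /Q; ring.
  congr re; rewrite [x + _]addrC flin.
  rewrite !(innerDl, innerDr, innerZl, innerZr) (innerC x h) inner_norm.
  rewrite (norm_ReE h).
  have tw : t * w = - (s * nw ^+ 2)%:C by rewrite /t rmorphM /= -ww; ring.
  have tt : t * t^* = (s ^+ 2 * nw ^+ 2)%:C.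
    rewrite /t rmorphM rmorphN /= conj_real conjCK [RHS]rmorphM /= -ww.
    by rewrite rmorphXn /=; ring.
  have -> : (- 2 * s * nw ^+ 2 + s ^+ 2 * nw ^+ 2 * N ^+ 2)%:C =
            2 * (t * w) + t * t^* * N%:C ^+ 2.
    by rewrite tw tt; ring.
  have -> : (t * '[h, x])^* = t^* * ('[h, x])^* by rewrite rmorphM.
  by rewrite -/N /w; clearbody t; ring.
have [d Qd] : exists d, forall x, d <= Q x.
  exists (- c ^+ 2) => x.
  have fx : re (f x) <= c * re `|x|.
    rewrite -lecR rmorphM /= -norm_ReE; apply: le_trans (fbnd x).
    by apply: le_trans (normc_ge_Re _); rewrite lecR ler_norm.
  have -> : Q x = re `|x| ^+ 2 - 2 * re (f x).
    rewrite /Q inner_norm norm_ReE mulr_natl mulr2n opprD.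
    by rewrite -rmorphXn !ReD !ReN /=; ring.
  by have := sqr_ge0 (re `|x| - c); lra.
have rangeQ : has_inf (range Q).
  split; first by exists (Q 0), 0.
  by exists d => _ [x _ <-].
have e2 : 0 < e ^+ 2 by rewrite exprn_gt0.
have [_ [x _ <-] Qx] := inf_adherent e2 rangeQ.
exists x => h; have [->|h0] := eqVneq h 0.
  have := fbnd 0; rewrite !normr0 !mulr0 normr_le0 => /eqP ->.
  by rewrite inner0l subr0 normr0.
rewrite norm_complex [ `|h|]norm_ReE -rmorphM lecR.
have N0 : 0 < re `|h| by rewrite -ltcR -norm_ReE normr_gt0.
(* The step [s = `|h|^-2] minimizes the quadratic polynomial of [QE]. *)
have := QE x h (re `|h| ^- 2); have := ge_inf rangeQ.2.
set n := re _ in N0 *; set k := Normc.normc _ => infQ /= Qxh.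
have := infQ _ (imageT Q (x + (- (n ^- 2)%:C * ('[h, x] - f h)^* ) *: h)).
rewrite Qxh -/k => {}infQ.
have kn : k ^+ 2 / n ^+ 2 < e ^+ 2.
  have n0 : n != 0 by rewrite gt_eqF.
  suff E : k ^+ 2 / n ^+ 2 =
      2 / n ^+ 2 * k ^+ 2 - n ^- 2 ^+ 2 * k ^+ 2 * n ^+ 2.
    by rewrite E; lra.
  by field.
rewrite -(@ler_pXn2r _ 2) ?nnegrE ?mulr_ge0 ?(ltW N0) ?(ltW e0) //.
  by rewrite exprMn -ler_pdivrMr ?exprn_gt0 // ltW.
by rewrite -ler0c -norm_complex.
Qed.

Lemma riesz_representation (f : H -> R[i]) (c : R) :
  (forall a x y, f (a *: x + y) = a * f x + f y) ->
  (forall x, `|f x| <= c%:C * `|x|) ->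
  exists u, forall h, f h = '[h, u].
Proof.
move=> flin fbnd.
have approx n : exists x, forall h, `|'[h, x] - f h| <= (n.+1%:R^-1)%:C * `|h|.
  by apply: riesz_representation_approx flin fbnd _; rewrite invr_gt0.
have [a aP] := choice approx.
(* Test the two approximate representers against their difference [d]. *)
have dist m n : `|a m - a n| <= (m.+1%:R^-1 + n.+1%:R^-1 : R)%:C.
  set d := a m - a n; have [->|d0] := eqVneq d 0.
    by rewrite normr0 ler0c addr_ge0 // invr_ge0.
  have dpos : 0 < `|d| by rewrite normr_gt0.
  rewrite -(ler_pM2r dpos) -expr2.
  rewrite -[_ ^+ 2]ger0_norm ?exprn_ge0 // -inner_norm {2}/d innerBr.
  have -> : '[d, a m] - '[d, a n] = ('[d, a m] - f d) - ('[d, a n] - f d).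
    by ring.
  apply: le_trans (ler_normB _ _) _.
  by rewrite rmorphD /= mulrDl lerD ?aP.
have : cauchy (a @ \oo).
  apply: cauchy_exP => _ /gt0_complex_real[eps eps0 ->].
  have eps2 : 0 < eps / 2 by rewrite divr_gt0.
  have [N _ NP] := near_infty_natSinv_lt (PosNum eps2).
  exists (a N); exists N => // m Nm; rewrite -ball_normE /ball_ /=.
  apply: le_lt_trans (dist N m) _.
  rewrite ltcR; have := NP m Nm; have := NP N (leqnn N) => /= Nk mk.
  by rewrite [eps]splitr ltrD.
move=> /cauchy_cvg /cvg_ex [u au]; exists u => h.
apply/eqP; rewrite eq_sym -subr_eq0 -normr_le0.
apply/ler_addgt0Pr => _ /gt0_complex_real[eps eps0 ->]; rewrite add0r.
(* The two error terms below are at most [k `|h|] each; the [+ 1] covers the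
   case [h = 0]. *)
pose k := eps / (2 * (re `|h| + 1)).
have h0 := Re_norm_ge0 h.
have k0 : 0 < k by rewrite divr_gt0 // mulr_gt0 // ltr_wpDl.
have k0' : 0 < k%:C by rewrite ltcR.
move/cvgrPdist_lt : au => /(_ _ k0') au.
have [n [un nk]] : exists n, `|u - a n| < k%:C /\ n.+1%:R^-1 < k.
  near \oo => n; exists n; split; near: n; first exact: au.
  exact: (near_infty_natSinv_lt (PosNum k0)).
have -> : '[h, u] - f h = '[h, u - a n] + ('[h, a n] - f h).
  by rewrite innerBr; ring.
apply: le_trans (ler_normD _ _) _.
apply: le_trans (lerD (cauchy_schwarz _ _) (aP n h)) _.
apply: (@le_trans _ _ (`|h| * k%:C + k%:C * `|h|)).
  by rewrite lerD ?ler_wpM2l ?ler_wpM2r ?lecR // ltW.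
rewrite norm_ReE -!rmorphM -rmorphD lecR.
have -> : eps = 2 * k * (re `|h| + 1) by rewrite /k; field; lra.
by nra.
Unshelve. all: by end_near. Qed.

(** * Adjoints *)

Implicit Types S T A B : H -> H.

Definition adjoint_pair T S := forall x y, '[T x, y] = '[x, S y].

Lemma adjoint_pairC T S : adjoint_pair T S -> adjoint_pair S T.
Proof. by move=> TS x y; rewrite innerC -TS -innerC. Qed.

Lemma adjointP T : bounded_operator T -> adjoint_pair T (adjoint T).
Proof.
move=> [linT [c Tc]].
have ex y : exists z, forall x, '[T x, y] = '[x, z].
  apply: (@riesz_representation _ (c * re `|y|)) => [a u v|x].
    by rewrite linT innerDl innerZl.
  apply: le_trans (cauchy_schwarz _ _) _.
  by rewrite rmorphM /= -norm_ReE mulrAC ler_wpM2r.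
have [S PS] := choice ex.
have TS : adjoint_pair T S by move=> x y; apply: PS.
exact: (@getPex _ [set S | adjoint_pair T S] (ex_intro _ S TS)).
Qed.

Lemma adjoint_unique T S : adjoint_pair T S -> adjoint T = S.
Proof.
move=> TS.
have TT : adjoint_pair T (adjoint T).
  exact: (@getPex _ [set S | adjoint_pair T S] (ex_intro _ S TS)).
apply/funext => y; apply/eqP; rewrite -subr_eq0 -normr_eq0 -sqrf_eq0.
by rewrite -inner_norm innerBr -TT -TS subrr.
Qed.

(** [`|S x|^2 = <T (S x), x> <= k `|S x| `|x|]. *)
Lemma adjoint_norm_le T S (k : R) : adjoint_pair T S ->
  (forall x, `|T x| <= k%:C * `|x|) -> forall x, `|S x| <= k%:C * `|x|.
Proof.
move=> TS Tk x; have [->|Sx0] := eqVneq (S x) 0.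
  by rewrite normr0; apply: le_trans (Tk x).
have pos : 0 < `|S x| by rewrite normr_gt0.
rewrite -(ler_pM2r pos) -expr2 -[_ ^+ 2]ger0_norm ?exprn_ge0 // -inner_norm -TS.
apply: le_trans (cauchy_schwarz _ _) _.
by rewrite mulrAC ler_wpM2r.
Qed.

(** * The numerical radius *)

(** The hypothesis [0 <= K] is for the zero space, whose numerical radii are the
    supremum [0] of the empty set. *)
Lemma numerical_radius_le T (K : R) : 0 <= K ->
  (forall x, `|x| = 1 -> `|'[T x, x]| <= K%:C) -> numerical_radius T <= K.
Proof.
move=> K0 TK; rewrite /numerical_radius.
set E := (X in sup X); have [->|E0] := eqVneq E set0; first by rewrite sup0.
apply: ge_sup; first exact/set0P.
by move=> _ [x /= x1 <-]; rewrite -lecR -norm_complex TK.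
Qed.

Lemma numerical_radiusZ (a : R[i]) T : `|a| = 1 ->
  numerical_radius (a \*: T) = numerical_radius T.
Proof.
move=> a1; congr sup; apply: eq_imagel => x _ /=; apply: complexI.
by rewrite -!norm_complex innerZl normrM a1 mul1r.
Qed.

Lemma numerical_radius_ge T x : bounded_operator T -> `|x| = 1 ->
  Normc.normc '[T x, x] <= numerical_radius T.
Proof.
move=> [_ [c Tc]] x1; apply: ub_le_sup; last by exists x.
exists c => _ [y /= y1 <-]; rewrite -lecR -norm_complex.
apply: le_trans (cauchy_schwarz _ _) _.
by rewrite y1 mulr1; have := Tc y; rewrite y1 mulr1.
Qed.

Lemma numerical_radius_ge0 T : bounded_operator T -> 0 <= numerical_radius T.
Proof.
move=> bT; rewrite /numerical_radius.
set E := (X in sup X); have [->|/set0P[_ [x /= x1 _]]] := eqVneq E set0.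
  by rewrite sup0.
apply: le_trans (_ : Normc.normc '[T x, x] <= _); last first.
  exact: numerical_radius_ge.
by rewrite -ler0c -norm_complex.
Qed.

Lemma inner_le_numerical_radius T x : bounded_operator T ->
  `|'[T x, x]| <= (numerical_radius T)%:C * `|x| ^+ 2.
Proof.
move=> bT; have [->|x0] := eqVneq x 0.
  by rewrite inner0r !normr0 expr0n mulr0.
have pos : 0 < `|x| by rewrite normr_gt0.
pose y := `|x|^-1 *: x.
have y1 : `|y| = 1 by rewrite normrZ normfV normr_id mulVf ?gt_eqF.
have Ty : T y = `|x|^-1 *: T x.
  have [linT _] := bT.
  exact: scalable_linear.
have := numerical_radius_ge bT y1.
rewrite -lecR -norm_complex Ty innerZl innerZr.
rewrite (geC0_conj (_ : 0 <= `|x|^-1)) ?invr_ge0 // !normrM normfV normr_id.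
by rewrite mulrA -invfM -expr2 mulrC ler_pdivrMr ?exprn_gt0.
Qed.

(** Polarization, with [i y] in place of [y]: the skew expression
    is [i / 2] times the difference of the values of the quadratic form of [B] at
    [x + i y] and [x - i y], vectors whose squared norms add up to [2 (`|x|^2 + `|y|^2)]. *)
Lemma skew_inner_le B x y : bounded_operator B ->
  `|'[B x, y] - '[B y, x]| <= (numerical_radius B)%:C * (`|x| ^+ 2 + `|y| ^+ 2).
Proof.
move=> bB; have [linB _] := bB.
pose z := 'i *: y.
have BD u a v : B (u + a *: v) = B u + a *: B v by rewrite addrC linB addrC.
have -> : '[B x, y] - '[B y, x] =
   2^-1 * 'i * ('[B (x + z), x + z] - '[B (x - z), x - z]).
  rewrite /z -scaleNr !BD !(innerDl, innerDr, innerZl, innerZr).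
  rewrite !rmorphN /= !conjCi.
  transitivity (- 'i ^+ 2 * ('[B x, y] - '[B y, x])); last by field.
  by rewrite sqrCi; ring.
rewrite !normrM normCi mulr1 normfV normr_nat.
rewrite mulrC ler_pdivrMr //.
apply: le_trans (ler_normB _ _) _.
apply: le_trans (lerD (inner_le_numerical_radius _ bB)
                      (inner_le_numerical_radius _ bB)) _.
rewrite -mulrDr parallelogram normrZ normCi mul1r.
by rewrite mulrCA mulrC.
Qed.

(** * Accretive transforms *)

(** With [u = A x - c x] and [v = r x], where [c] and [r] are the midpoint and
    the half-length of [[m, M]], the quadratic form of [Re_op (C_op M m A)] is
    [Re <u + v, v - u> = `|v|^2 - `|u|^2]. *)
Lemma accretive_C_op_norm_le (M m : R) A : m <= M -> bounded_operator A ->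
  accretive (C_op M m A) -> forall x,
  `|A x - ((M + m) / 2)%:C *: x| <= ((M - m) / 2)%:C * `|x|.
Proof.
move=> mM bA accA x.
pose S := (adjoint A \- m%:C \*: idfun) \o (M%:C \*: idfun \- A).
have CS y z : '[C_op M m A y, z] = '[A y - m%:C *: y, M%:C *: z - A z].
  rewrite /C_op /= [LHS]innerBl [RHS]innerBr innerZl innerZr conj_real.
  by rewrite (adjoint_pairC (adjointP bA)).
have adjC : adjoint_pair (C_op M m A) S.
  move=> y z; rewrite CS /S /= innerBl innerZl [RHS]innerBr innerZr.
  by rewrite conj_real (adjointP bA).
have := accA x.
rewrite /Re_op (adjoint_unique adjC) /= innerZl innerDl.
rewrite (innerC (S x)) -adjC CS -innerC.
rewrite pmulr_rge0 ?invr_gt0 //.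
set u := A x - ((M + m) / 2)%:C *: x; set v := ((M - m) / 2)%:C *: x.
have -> : A x - m%:C *: x = u + v.
  by rewrite /u /v -addrA -!scaleNr -scalerDl; congr (_ + _ *: _); field.
have -> : M%:C *: x - A x = v - u.
  by rewrite /u /v opprB addrA -scalerDl; congr (_ *: _ - _); field.
have -> : '[u + v, v - u] + '[v - u, u + v] = 2 * (`|v| ^+ 2 - `|u| ^+ 2).
  move: u v => u v.
  by rewrite !(innerBl, innerBr, innerDl, innerDr) !inner_norm; ring.
rewrite pmulr_rge0 // subr_ge0 ler_pXn2r ?nnegrE //.
by rewrite /v normrZ ger0_norm ?ler0c // divr_ge0 // subr_ge0.
Qed.

(** For a unit vector [x], [A^* x = c x + r v] with [`|v| <= 1]; the real number
    [c] cancels out of [<B x, A^* x> - <B A^* x, x>]. *)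
Lemma numerical_radius_sub_adjoint_le (M m : R) A B : m < M ->
  bounded_operator A -> bounded_operator B -> accretive (C_op M m A) ->
  numerical_radius ((A \o B) \- (B \o adjoint A))
    <= (M - m) * numerical_radius B.
Proof.
move=> mM bA bB accA; have [linB _] := bB.
set w := numerical_radius B.
have w0 : 0 <= w by exact: numerical_radius_ge0.
pose r := (M - m) / 2; pose c := (M + m) / 2.
have r0 : 0 < r by rewrite divr_gt0 // subr_gt0.
apply: numerical_radius_le; first by rewrite mulr_ge0 // subr_ge0 ltW.
move=> x x1.
have shifted : adjoint_pair (A \- c%:C \*: idfun) (adjoint A \- c%:C \*: idfun).
  move=> y z; rewrite /= innerBl innerBr innerZl innerZr conj_real.
  by rewrite (adjointP bA).
have [v v1 Ax] : exists2 v, `|v| <= 1 & adjoint A x = r%:C *: v + c%:C *: x.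
  have := adjoint_norm_le shifted (accretive_C_op_norm_le (ltW mM) bA accA) x.
  rewrite /= x1 mulr1 -/r => dist.
  exists (r^-1%:C *: (adjoint A x - c%:C *: x)).
    rewrite normrZ ger0_norm ?ler0c ?invr_ge0 ?(ltW r0) //.
    by rewrite fmorphV ler_pdivrMl ?ltcR // mulr1.
  by rewrite scalerA fmorphV mulfV ?scale1r ?subrK // gt_eqF // ltcR.
have -> : '[((A \o B) \- (B \o adjoint A)) x, x] =
    r%:C * ('[B x, v] - '[B v, x]).
  rewrite /= innerBl (adjointP bA) Ax.
  have -> : B (r%:C *: v + c%:C *: x) = r%:C *: B v + c%:C *: B x.
    by rewrite linB (scalable_linear linB).
  by rewrite innerDl innerDr !innerZl !innerZr !conj_real; ring.
rewrite normrM ger0_norm ?ler0c ?(ltW r0) //.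
have -> : (M - m) * w = r * (w * 2) by rewrite /r; field.
clearbody r; rewrite rmorphM /= ler_wpM2l ?ler0c ?(ltW r0) //.
apply: le_trans (skew_inner_le _ _ bB) _.
rewrite rmorphM /= ler_wpM2l ?ler0c //.
by rewrite x1 expr1n rmorph_nat lerD // exprn_ile1.
Qed.

Lemma bounded_operatorZ (a : R[i]) T :
  bounded_operator T -> bounded_operator (a \*: T).
Proof.
move=> [linT [c Tc]]; split.
  by move=> b x y /=; rewrite linT scalerDr !scalerA mulrC.
exists (Normc.normc a * c) => x /=.
by rewrite normrZ rmorphM /= -norm_complex -mulrA ler_wpM2l.
Qed.

End HilbertOperators.

Theorem theorem3p3 (R : realType) (M m : R) (H : hilbertType R) (A B : H -> H) :
  0 < m < M -> bounded_operator A -> bounded_operator B ->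
  (accretive (C_op M m A) ->
     numerical_radius ((A \o B) \- (B \o adjoint A))
       <= (M - m) * numerical_radius B) /\
  (accretive (C_op M m ('i%C \*: A)) ->
     numerical_radius ((A \o B) \+ (B \o adjoint A))
       <= (M - m) * numerical_radius B).
Proof.
move=> /andP[_ mM] bA bB; split=> [|acc].
  exact: numerical_radius_sub_adjoint_le.
have biA := bounded_operatorZ 'i%C bA.
apply: le_trans (numerical_radius_sub_adjoint_le mM biA bB acc).
have adjiA : adjoint ('i%C \*: A) = - 'i%C \*: adjoint A.
  apply: adjoint_unique => x y /=.
  by rewrite innerZl innerZr (adjointP bA) complexiE rmorphN /= conjCi opprK.
have -> : (('i%C \*: A) \o B) \- (B \o adjoint ('i%C \*: A)) =
    'i%C \*: ((A \o B) \+ (B \o adjoint A)).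
  apply/funext => x; rewrite adjiA /=.
  by rewrite (scalable_linear bB.1) /= scaleNr opprK -scalerDr.
by rewrite numerical_radiusZ // complexiE normCi.
Qed.
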